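(* Let $F_8=y_1^3+\cdots+y_8^3$ where $y_1+\cdots+y_8=0$. Put $$\begin{aligned} y_1&=-3e_0-2e_1+4e_2+2e_3+2e_4,\\ y_2&=-3e_0-2e_2+4e_1+2e_3+2e_4,\\ y_3&=3e_0+2e_4-4e_3-2e_1-2e_2,\\ y_4&=3e_0+2e_3-4e_4-2e_1-2e_2,\\ y_5&=-9e_0+4e_1+4e_2+2e_3+2e_4+6e_5,\\ y_6&=-9e_0+4e_1+4e_2+2e_3+2e_4+6e_6,\\ y_7&=9e_0-4e_3-4e_4-2e_1-2e_2-6e_5-6e_6,\\ y_8&=9e_0-4e_1-4e_2-2e_3-2e_4, \end{aligned}$$ so that $y_1+\cdots+y_8=0$. Then, with this substitution, $$F_8=-2^4\cdot3^4\cdot hA_{00}(e_0,\dots,e_6).$$ Conversely, put $$\begin{aligned} e_1&=-2y_1-y_2-3y_3-3y_4-y_5-y_6-y_7,\\ e_2&=-2y_2-y_1-3y_3-3y_4-y_5-y_6-y_7,\\ e_3&=-2y_3-y_4-y_5-y_6-y_7,\\ e_4&=-2y_4-y_3-y_5-y_6-y_7,\\ e_5&=-y_1-y_2-y_3-y_4-y_6-y_7,\\ e_6&=-y_1-y_2-y_3-y_4-y_7-y_5,\\ e_7&=-y_1-y_2-y_3-y_4-y_5-y_6,\\ e_0&=-2y_1-2y_2-4y_3-4y_4-2y_5-2y_6-2y_7, \end{aligned}$$ so that $e_1+\cdots+e_7=3e_0$. Then, with this substitution, $$hA_{00}=-F_8/6 .$$ Moreover, the invariance of $A_{00}$ under permutations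 of $\{e_1,e_2\}$, of $\{e_3,e_4\}$ and of $\{e_5,e_6,e_7\}$ is translated, in terms of the $y$-coordinates, into the permutations of $\{y_1,y_2\}$, $\{y_3,y_4\}$ and $\{y_5,y_6,y_7\}$, respectively.
   Context: The cubic polynomial $A_{00}(e_1,\dots,e_6)$ is defined, with $e_7:=3-(e_1+\cdots+e_6)$, by $$\begin{aligned}54A_{00}=&-4(e_1+e_2-e_3-e_4)^3-27e_5e_6e_7+9(e_1+e_2-e_3-e_4)(e_5e_6+e_5e_7+e_6e_7-2)\\&+9e_1e_2(e_1+e_2-1)+18(e_1+e_2-1)(e_3^2+e_3e_4+e_4^2)\\&-9e_3e_4(e_3+e_4-1)-18(e_3+e_4-1)(e_1^2+e_1e_2+e_2^2).\end{aligned}$$ Its homogenization is $hA_{00}(e_0,\dots,e_6):=e_0^3\cdot A_{00}(e_1/e_0,\dots,e_6/e_0)$; in homogeneous coordinates the relation between the exponents reads $e_7=3e_0-(e_1+\cdots+e_6)$. *)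

(* Defs.v *)
From mathcomp Require Import all_boot all_order all_algebra.
From mathcomp.multinomials Require Export mpoly.
Set Implicit Arguments.
Unset Strict Implicit.
Unset Printing Implicit Defensive.
Import GRing.Theory.
Local Open Scope ring_scope.
Local Notation "x %:F" := (@FracField.tofrac _ x) : ring_scope.

(* Families of coordinates are functions of a natural number, so that e_i and
   y_i are written e i and y i with their usual indices; they are 0 outside
   their index range. *)

(* e_1, ..., e_6 are the variables, and e_7 = 3 - (e_1 + ... + e_6). *)
Definition aff_coord (i : nat) : {mpoly rat[6]} :=
  if (0 < i < 7)%N then 'X_(inord i.-1)
  else if i == 7%N then 3 - \sum_(j < 6) 'X_j
  else 0.

(* e_0, ..., e_6 are the variables, and e_7 = 3 e_0 - (e_1 + ... + e_6). *)
Definition hom_coord (i : nat) : {mpoly rat[7]} :=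
  if (i < 7)%N then 'X_(inord i)
  else if i == 7%N then 3 * 'X_(inord 0) - \sum_(1 <= j < 7) 'X_(inord j)
  else 0.

(* The hyperplane y_1 + ... + y_8 = 0: y_1, ..., y_7 are the variables, and
   y_8 = - (y_1 + ... + y_7). *)
Definition y_coord (i : nat) : {mpoly rat[7]} :=
  if (0 < i < 8)%N then 'X_(inord i.-1)
  else if i == 8%N then - \sum_(j < 7) 'X_j
  else 0.

Definition A00 : {mpoly rat[6]} :=
  let e1 := aff_coord 1 in let e2 := aff_coord 2 in let e3 := aff_coord 3 in
  let e4 := aff_coord 4 in let e5 := aff_coord 5 in let e6 := aff_coord 6 in
  let e7 := aff_coord 7 in
  54^-1 *: (
    - 4 * (e1 + e2 - e3 - e4) ^+ 3 - 27 * e5 * e6 * e7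
    + 9 * (e1 + e2 - e3 - e4) * (e5 * e6 + e5 * e7 + e6 * e7 - 2)
    + 9 * e1 * e2 * (e1 + e2 - 1)
    + 18 * (e1 + e2 - 1) * (e3 ^+ 2 + e3 * e4 + e4 ^+ 2)
    - 9 * e3 * e4 * (e3 + e4 - 1)
    - 18 * (e3 + e4 - 1) * (e1 ^+ 2 + e1 * e2 + e2 ^+ 2)).

(* Degree d homogenization for polynomials p of degree at most d; the new
   variable is 'X_0, and the old variable 'X_i becomes 'X_(i+1). *)
Definition homogenize (R : nzRingType) (n d : nat) (p : {mpoly R[n]}) :
    {mpoly R[n.+1]} :=
  \sum_(m <- msupp p)
    p@_m *: ('X_ord0 ^+ (d - mdeg m) * \prod_(i < n) 'X_(lift ord0 i) ^+ m i).

Definition hA00 : {mpoly rat[7]} := homogenize 3 A00.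

(* The values p(e_1/e_0, ..., e_n/e_0) are taken in the fraction field. *)
Lemma homogenizeE (R : idomainType) (n d : nat) (p : {mpoly R[n]}) :
  (msize p <= d.+1)%N ->
  (homogenize d p)%:F =
  ('X_ord0)%:F ^+ d *
  mmap (fun c : R => (c%:MP_[n.+1])%:F)
       (fun i : 'I_n => ('X_(lift ord0 i))%:F / ('X_ord0)%:F) p.
Proof.
move=> led; have x0 : ('X_ord0 : {mpoly R[n.+1]})%:F != 0.
  by rewrite tofrac_eq0 -msize_poly_eq0 msizeX.
rewrite /homogenize /mmap rmorph_sum mulr_sumr !big_seq.
apply: eq_bigr => m m_p; rewrite -mul_mpolyC !rmorphM /= [RHS]mulrCA.
congr (_ * _).
have lem : (mdeg m <= d)%N by rewrite -ltnS (leq_trans (msize_mdeg_lt m_p)).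
rewrite rmorphXn rmorph_prod /= /mmap1.
under [in RHS]eq_bigr do rewrite expr_div_n.
rewrite prodf_div prodrXr -mdegE -[in RHS](subnK lem) exprD -!mulrA.
congr (_ * _); rewrite mulrCA divff ?expf_neq0 // mulr1.
by apply: eq_bigr => i _; rewrite rmorphXn.
Qed.

Lemma msizeM_leS (R : idomainType) (n a b : nat) (p q : {mpoly R[n]}) :
  (msize p <= a.+1 -> msize q <= b.+1 -> msize (p * q) <= (a + b).+1)%N.
Proof.
have [->|p0] := eqVneq p 0; first by rewrite mul0r msize0.
have [->|q0] := eqVneq q 0; first by rewrite mulr0 msize0.
move=> lea leb; rewrite msizeM //.
rewrite -subn1 leq_subLR add1n (leq_trans (leq_add lea leb)) //.
by rewrite addSn addnS.
Qed.

Lemma msizeD_leS (R : nzRingType) (n a : nat) (p q : {mpoly R[n]}) :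
  (msize p <= a -> msize q <= a -> msize (p + q) <= a)%N.
Proof.
by move=> lea leb; rewrite (leq_trans (mmeasureD_le _ _ _)) ?geq_max ?lea.
Qed.

Lemma msize_nat (R : nzRingType) (n k : nat) :
  (msize (k%:R : {mpoly R[n]}) <= 1)%N.
Proof. by rewrite -mpolyC_nat msizeC leq_b1. Qed.

Lemma msize_aff_coord i : (msize (aff_coord i) <= 2)%N.
Proof.
rewrite /aff_coord; case: ifP => _; first by rewrite msizeX mdeg1.
case: ifP => _; last by rewrite msize0.
apply: msizeD_leS; first exact: leq_trans (msize_nat _ _ _) _.
rewrite mmeasureN; elim/big_ind: _ => [|p q|j _]; first by rewrite msize0.
  exact: msizeD_leS.
by rewrite msizeX mdeg1.
Qed.

Lemma msize_A00 : (msize A00 <= 4)%N.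
Proof.
pose le k (p : {mpoly rat[6]}) := (msize p <= k.+1)%N.
have leW j k p : (j <= k)%N -> le j p -> le k p.
  by move=> jk lej; apply: leq_trans lej _.
have leD k p q : le k p -> le k q -> le k (p + q) by exact: msizeD_leS.
have leN k p : le k p -> le k (- p) by rewrite /le mmeasureN.
have leM1 k p q : le 1%N p -> le k q -> le k.+1 (p * q).
  exact: msizeM_leS.
have leC k c : le k c%:R by apply: (leW 0%N) => //; apply: msize_nat.
have leMC k c p : le k p -> le k (c%:R * p).
  by apply: (@msizeM_leS _ _ 0 k); apply: (leC 0%N).
have leE i : le 1%N (aff_coord i) by exact: msize_aff_coord.
have leEE i j : le 2%N (aff_coord i * aff_coord j) by rewrite leM1 ?leE.
have leL i j : le 1%N (aff_coord i + aff_coord j - 1).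
  by rewrite !leD ?leN ?leE ?(leC _ 1%N).
rewrite /A00 (leq_trans (msizeZ_le _ _)) // -/(le 3%N _).
rewrite -!mulrA mulNr !exprS expr0 !mulr1.
rewrite !leD ?leN ?leMC ?leM1 //.
all: by rewrite ?leM1 ?leL ?leE // ?leD ?leN ?leEE ?leE ?leC.
Qed.

Lemma hA00E :
  hA00%:F =
  ('X_ord0)%:F ^+ 3 *
  mmap (fun c : rat => (c%:MP_[7])%:F)
       (fun i : 'I_6 => ('X_(lift ord0 i))%:F / ('X_ord0)%:F) A00.
Proof. exact: homogenizeE msize_A00. Qed.

Definition F8 (R : nzRingType) (y : nat -> R) : R := \sum_(1 <= i < 9) y i ^+ 3.

Definition y_of_e (R : nzRingType) (e : nat -> R) (i : nat) : R :=
  let e0 := e 0%N in let e1 := e 1%N in let e2 := e 2%N in let e3 := e 3%N in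
  let e4 := e 4%N in let e5 := e 5%N in let e6 := e 6%N in
  match i with
  | 1 => - 3 * e0 - 2 * e1 + 4 * e2 + 2 * e3 + 2 * e4
  | 2 => - 3 * e0 - 2 * e2 + 4 * e1 + 2 * e3 + 2 * e4
  | 3 => 3 * e0 + 2 * e4 - 4 * e3 - 2 * e1 - 2 * e2
  | 4 => 3 * e0 + 2 * e3 - 4 * e4 - 2 * e1 - 2 * e2
  | 5 => - 9 * e0 + 4 * e1 + 4 * e2 + 2 * e3 + 2 * e4 + 6 * e5
  | 6 => - 9 * e0 + 4 * e1 + 4 * e2 + 2 * e3 + 2 * e4 + 6 * e6
  | 7 => 9 * e0 - 4 * e3 - 4 * e4 - 2 * e1 - 2 * e2 - 6 * e5 - 6 * e6
  | 8 => 9 * e0 - 4 * e1 - 4 * e2 - 2 * e3 - 2 * e4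
  | _ => 0
  end.

Definition e_of_y (R : nzRingType) (y : nat -> R) (i : nat) : R :=
  let y1 := y 1%N in let y2 := y 2%N in let y3 := y 3%N in let y4 := y 4%N in
  let y5 := y 5%N in let y6 := y 6%N in let y7 := y 7%N in
  match i with
  | 0 => - 2 * y1 - 2 * y2 - 4 * y3 - 4 * y4 - 2 * y5 - 2 * y6 - 2 * y7
  | 1 => - 2 * y1 - y2 - 3 * y3 - 3 * y4 - y5 - y6 - y7
  | 2 => - 2 * y2 - y1 - 3 * y3 - 3 * y4 - y5 - y6 - y7
  | 3 => - 2 * y3 - y4 - y5 - y6 - y7
  | 4 => - 2 * y4 - y3 - y5 - y6 - y7
  | 5 => - y1 - y2 - y3 - y4 - y6 - y7
  | 6 => - y1 - y2 - y3 - y4 - y7 - y5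
  | 7 => - y1 - y2 - y3 - y4 - y5 - y6
  | _ => 0
  end.

Definition subst_aff (p : {mpoly rat[6]}) (e : nat -> {mpoly rat[6]}) :
    {mpoly rat[6]} :=
  p \mPo [tuple e i.+1 | i < 6].

Definition subst_hom (p : {mpoly rat[7]}) (e : nat -> {mpoly rat[7]}) :
    {mpoly rat[7]} :=
  p \mPo [tuple e i | i < 7].

Definition permutes (B : seq nat) (s : nat -> nat) : Prop :=
  bijective s /\ forall i, i \notin B -> s i = i.

Definition blocks : seq (seq nat) :=
  [:: [:: 1; 2]; [:: 3; 4]; [:: 5; 6; 7]]%N.

(* Main.v *)
Require Import Defs.
From mathcomp Require Import all_boot all_order all_algebra.
From mathcomp Require Import ring.
Set Implicit Arguments.
Unset Strict Implicit.
Unset Printing Implicit Defensive.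
Import GRing.Theory.
Local Open Scope ring_scope.
Local Notation "x %:F" := (@FracField.tofrac _ x) : ring_scope.

(** With [e_7] kept as a variable, [54 hA00] becomes the cubic form [cubic], restricted to the
    hyperplane [e_1 + ... + e_7 = 3 e_0] ([hA00_cubic]). Both substitutions are then ring identities
    valid over any commutative ring: [F8_y_of_e] gives the factor -24 on that hyperplane, and
    [cubic_e_of_y] gives -9 where the [y_i] sum to 0. Dividing by 54 turns these into the stated
    constants, since 24 * 54 = 2^4 * 3^4 and 9 / 54 = 1/6. For the symmetries, a permutation
    supported in one block is one of eight explicit ones ([block_permutation]), and each case is
    again a ring identity. *)

(* [cubic e] is 54 hA_00(e_0, ..., e_6), with e_7 kept as an eighth variable: it
   is then a form over any ring, and hA_00 is its restriction to
   e_1 + ... + e_7 = 3 e_0. *)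
Definition cubic (R : comNzRingType) (e : nat -> R) : R :=
  let e0 := e 0%N in let e1 := e 1%N in let e2 := e 2%N in let e3 := e 3%N in
  let e4 := e 4%N in let e5 := e 5%N in let e6 := e 6%N in let e7 := e 7%N in
  - 4 * (e1 + e2 - e3 - e4) ^+ 3 - 27 * e5 * e6 * e7
  + 9 * (e1 + e2 - e3 - e4) * (e5 * e6 + e5 * e7 + e6 * e7 - 2 * e0 ^+ 2)
  + 9 * e1 * e2 * (e1 + e2 - e0)
  + 18 * (e1 + e2 - e0) * (e3 ^+ 2 + e3 * e4 + e4 ^+ 2)
  - 9 * e3 * e4 * (e3 + e4 - e0)
  - 18 * (e3 + e4 - e0) * (e1 ^+ 2 + e1 * e2 + e2 ^+ 2).

(** The sum pins down the seventh coordinate, so the image of [e_7] under a substitution never has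
    to be computed: linearity of the sum suffices. *)
Lemma eq_cubic (R : comNzRingType) (e e' : nat -> R) :
  (forall i, (i < 7)%N -> e i = e' i) ->
  \sum_(1 <= i < 8) e i = \sum_(1 <= i < 8) e' i -> cubic e = cubic e'.
Proof.
move=> ee'; rewrite !(big_nat_recr 7 1) //= (eq_big_nat _ _ (F2 := e')).
  by move/addrI=> e7; rewrite /cubic e7 !ee'.
by move=> i /andP[_ i7]; exact: ee'.
Qed.

Lemma cubicM (R : comNzRingType) (c : R) (e : nat -> R) :
  cubic (fun i => c * e i) = c ^+ 3 * cubic e.
Proof. rewrite /cubic; ring. Qed.

Lemma rmorph_cubic (R S : comNzRingType) (f : {rmorphism R -> S})
    (e : nat -> R) :
  f (cubic e) = cubic (f \o e).
Proof. rewrite /cubic /=; ring. Qed.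

(** The affine chart [e_0 = 1]; the value at 0, a mere default in [aff_coord], is overridden. *)
Definition dehom (R : nzRingType) (e : nat -> R) (i : nat) : R :=
  if i is 0 then 1 else e i.

Lemma A00_cubic : A00 = 54^-1 *: cubic (dehom aff_coord).
Proof. by rewrite /A00 /cubic /= expr1n mulr1. Qed.

Lemma sum_aff_coord : \sum_(1 <= i < 8) aff_coord i = 3.
Proof.
rewrite (big_nat_recr 7 1) //= big_add1 big_mkord /=.
rewrite (eq_bigr (fun i : 'I_6 => 'X_i)) => [|i _].
  by rewrite /aff_coord /= addrC subrK.
rewrite /aff_coord /= ltnS ltn_ord; congr 'X_(_); exact: inord_val.
Qed.

Lemma sum_hom_coord : \sum_(1 <= i < 8) hom_coord i = 3 * hom_coord 0.
Proof.
rewrite (big_nat_recr 7 1) //= (eq_big_nat _ _ (F2 := fun i => 'X_(inord i))).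
  by rewrite /hom_coord /= addrC subrK.
by move=> i /andP[_ i7]; rewrite /hom_coord i7.
Qed.

Lemma sum_dehom (R : nzRingType) (e : nat -> R) :
  \sum_(1 <= i < 8) dehom e i = \sum_(1 <= i < 8) e i.
Proof. by apply: eq_big_nat => -[]. Qed.

Lemma hA00_cubic : hA00 = 54^-1 *: cubic hom_coord.
Proof.
apply/eqP; rewrite -tofrac_eq; apply/eqP; rewrite hA00E A00_cubic.
(* Writing the coefficient map as a composite of ring morphisms lets [mmap] be used as a ring
   morphism. *)
rewrite -[mmap _ _]/(mmap (@FracField.tofrac _ \o @mpolyC 7 rat) _) mmapZ.
rewrite -mul_mpolyC rmorphM /= mulrCA; congr (_ * _).
have x0 : ('X_ord0 : {mpoly rat[7]})%:F != 0.
  by rewrite tofrac_eq0 -msize_poly_eq0 msizeX.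
(* Homogeneity absorbs [e_0 ^+ 3] into the arguments: 1 becomes [e_0], and each [e_i / e_0] becomes
   [e_i]. *)
rewrite (rmorph_cubic (mmap _ _)) -cubicM rmorph_cubic.
apply: eq_cubic => [[_|i]|] /=.
- rewrite rmorph1 mulr1 /hom_coord; congr (_%:F); congr 'X_(_).
  by apply: val_inj; rewrite /= inordK.
- move=> i7; rewrite /aff_coord /hom_coord /= i7 mmapX mmap1U.
  rewrite mulrC divfK //; congr (_%:F); congr 'X_(_).
  by apply: val_inj; rewrite /= !inordK.
rewrite -mulr_sumr -!rmorph_sum sum_dehom sum_aff_coord sum_hom_coord.
rewrite rmorphM !rmorph_nat mulrC; congr (_ * _%:F).
by rewrite /hom_coord; congr 'X_(_); apply: val_inj; rewrite /= inordK.
Qed.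

Lemma subst_hA00 (e : nat -> {mpoly rat[7]}) :
  \sum_(1 <= i < 8) e i = 3 * e 0%N -> subst_hom hA00 e = 54^-1 *: cubic e.
Proof.
move=> sum_e; rewrite hA00_cubic /subst_hom comp_mpolyZ; congr (_ *: _).
have subst_coord i : (i < 7)%N -> hom_coord i \mPo [tuple e i | i < 7] = e i.
  by move=> i7; rewrite /hom_coord i7 comp_mpolyXU -tnth_nth tnth_mktuple inordK.
rewrite rmorph_cubic; apply: eq_cubic => //=.
by rewrite -rmorph_sum sum_hom_coord sum_e rmorphM rmorph_nat /= subst_coord.
Qed.

Lemma subst_A00 (e : nat -> {mpoly rat[6]}) :
  \sum_(1 <= i < 8) e i = 3 -> subst_aff A00 e = 54^-1 *: cubic (dehom e).
Proof.
move=> sum_e; rewrite A00_cubic /subst_aff comp_mpolyZ; congr (_ *: _).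
rewrite rmorph_cubic; apply: eq_cubic => [[_|i]|] /=; first exact: rmorph1.
  move=> i7; rewrite /aff_coord /= i7 comp_mpolyXU.
  by rewrite -tnth_nth tnth_mktuple inordK.
by rewrite -rmorph_sum !sum_dehom sum_aff_coord sum_e rmorph_nat.
Qed.

(** If [s i] left [C] it would lie outside [B], hence be fixed by [s]; injectivity then gives
    [s i = i], which is in [C]. So [s] maps the finite set [C] injectively into itself. *)
Lemma permutes_perm_eq (B C : seq nat) (s : nat -> nat) :
  {subset B <= C} -> uniq C -> permutes B s -> perm_eq [seq s i | i <- C] C.
Proof.
move=> BC C_uniq [/bij_inj s_inj s_out].
have sC_uniq : uniq [seq s i | i <- C] by rewrite map_inj_uniq.
have sC : {subset [seq s i | i <- C] <= C}.
  move=> _ /mapP[i iC ->]; apply/negPn/negP => siC.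
  have siB : s i \notin B by apply: contra siC => /BC.
  by have /s_inj si := s_out _ siB; rewrite si iC in siC.
apply: uniq_perm => //.
by have [] := uniq_min_size sC_uniq sC; rewrite size_map.
Qed.

Lemma sum_permutes (R : nmodType) (B : seq nat) (s : nat -> nat) (m n : nat)
    (F : nat -> R) :
  {subset B <= index_iota m n} -> permutes B s ->
  \sum_(m <= i < n) F (s i) = \sum_(m <= i < n) F i.
Proof.
move=> BI s_perm; rewrite -(big_map s predT).
by apply/perm_big/(permutes_perm_eq BI) => //; apply: iota_uniq.
Qed.

Lemma blocks_sub (B : seq nat) :
  B \in blocks -> {subset B <= index_iota 1 8}.
Proof. by rewrite !inE => /or3P[] /eqP->; apply/allP. Qed.

Lemma block_permutation (B : seq nat) (s : nat -> nat) :
  B \in blocks -> permutes B s ->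
  [seq s i | i <- iota 0 9] \in
    [:: [:: 0; 1; 2; 3; 4; 5; 6; 7; 8];
        [:: 0; 2; 1; 3; 4; 5; 6; 7; 8];
        [:: 0; 1; 2; 4; 3; 5; 6; 7; 8];
        [:: 0; 1; 2; 3; 4; 5; 7; 6; 8];
        [:: 0; 1; 2; 3; 4; 6; 5; 7; 8];
        [:: 0; 1; 2; 3; 4; 6; 7; 5; 8];
        [:: 0; 1; 2; 3; 4; 7; 5; 6; 8];
        [:: 0; 1; 2; 3; 4; 7; 6; 5; 8]]%N.
Proof.
move=> Bb s_perm; have [_ s_out] := s_perm.
have : [seq s i | i <- B] \in permutations B.
  rewrite mem_permutations (permutes_perm_eq _ _ s_perm) //.
  by move: Bb; rewrite !inE => /or3P[] /eqP->.
move: Bb s_out; rewrite !inE => /or3P[] /eqP-> s_out.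
all: rewrite /= !inE.
(* [isT] proves [i \notin B] by computation, so exactly the points outside the
   block are rewritten. *)
all: do ?[rewrite (s_out 0%N isT) | rewrite (s_out 1%N isT)
  | rewrite (s_out 2%N isT)
  | rewrite (s_out 3%N isT) | rewrite (s_out 4%N isT) | rewrite (s_out 5%N isT)
  | rewrite (s_out 6%N isT) | rewrite (s_out 7%N isT) | rewrite (s_out 8%N isT)].
all: do ?case/orP; by move/eqP; case; do !move->.
Qed.

Lemma coord7 (R : comNzRingType) (e : nat -> R) :
  \sum_(1 <= i < 8) e i = 3 * e 0%N ->
  e 7%N = 3 * e 0%N - (e 1%N + e 2%N + e 3%N + e 4%N + e 5%N + e 6%N).
Proof. by rewrite unlock /= => <-; ring. Qed.

(** The relation is what makes [y_7] the analogue of [y_5] and [y_6]: eliminating [e_6] in favour of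
    [e_7] gives it the same shape. *)
Lemma y_of_e_block (R : comNzRingType) (e : nat -> R) (B : seq nat)
    (s : nat -> nat) (i : nat) :
  \sum_(1 <= i < 8) e i = 3 * e 0%N -> B \in blocks -> permutes B s ->
  (0 < i < 9)%N -> y_of_e (e \o s) i = y_of_e e (s i).
Proof.
move=> /coord7 e7 Bb s_perm.
move: (block_permutation Bb s_perm); rewrite !inE.
move: i => [|[|[|[|[|[|[|[|[|]]]]]]]]] //.
all: do ?case/orP; move/eqP; case=> s0 s1 s2 s3 s4 s5 s6 s7 s8 _.
all: rewrite /y_of_e /= ?s0 ?s1 ?s2 ?s3 ?s4 ?s5 ?s6 ?s7 ?s8.
all: rewrite /= ?e7; ring.
Qed.

Lemma e_of_y_block (R : comNzRingType) (y : nat -> R) (B : seq nat)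
    (s : nat -> nat) (i : nat) :
  B \in blocks -> permutes B s ->
  (i < 8)%N -> e_of_y (y \o s) i = e_of_y y (s i).
Proof.
move=> Bb s_perm; move: (block_permutation Bb s_perm); rewrite !inE.
move: i => [|[|[|[|[|[|[|[|]]]]]]]] //.
all: do ?case/orP; move/eqP; case=> s0 s1 s2 s3 s4 s5 s6 s7 s8 _.
all: rewrite /e_of_y /= ?s0 ?s1 ?s2 ?s3 ?s4 ?s5 ?s6 ?s7 ?s8.
all: rewrite /=; ring.
Qed.

(** The symmetry is formal in the eight variables, so no relation among the [e_i] is assumed. *)
Lemma cubic_block (R : comNzRingType) (e : nat -> R) (B : seq nat)
    (s : nat -> nat) :
  B \in blocks -> permutes B s -> cubic (e \o s) = cubic e.
Proof.
move=> Bb s_perm; move: (block_permutation Bb s_perm); rewrite !inE.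
all: do ?case/orP; move/eqP; case=> s0 s1 s2 s3 s4 s5 s6 s7 s8.
all: rewrite /cubic /= ?s0 ?s1 ?s2 ?s3 ?s4 ?s5 ?s6 ?s7 ?s8.
all: ring.
Qed.

Lemma sum_y_of_e (R : comNzRingType) (e : nat -> R) :
  \sum_(1 <= i < 9) y_of_e e i = 0.
Proof. rewrite unlock /= /y_of_e; ring. Qed.

Lemma F8_y_of_e (R : comNzRingType) (e : nat -> R) :
  \sum_(1 <= i < 8) e i = 3 * e 0%N ->
  F8 (y_of_e e) = - (2 ^+ 3 * 3) * cubic e.
Proof.
move=> /coord7 e7; rewrite /F8 /cubic unlock /= e7; ring.
Qed.

Lemma sum_e_of_y (R : comNzRingType) (y : nat -> R) :
  \sum_(1 <= i < 8) e_of_y y i = 3 * e_of_y y 0.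
Proof. rewrite unlock /= /e_of_y; ring. Qed.

Lemma cubic_e_of_y (R : comNzRingType) (y : nat -> R) :
  \sum_(1 <= i < 9) y i = 0 -> cubic (e_of_y y) = - 9 * F8 y.
Proof.
rewrite (big_nat_recr 8 1) //= addrC => /eqP; rewrite addr_eq0 => /eqP y8.
rewrite /F8 (big_nat_recr 8 1) //= y8 unlock /cubic /=; ring.
Qed.

Lemma sum_y_coord : \sum_(1 <= i < 9) y_coord i = 0.
Proof.
rewrite (big_nat_recr 8 1) //= big_add1 big_mkord.
rewrite (eq_bigr (fun i : 'I_7 => 'X_i)) => [|i _]; first exact: subrr.
by rewrite /y_coord /= ltnS ltn_ord inord_val.
Qed.

Theorem theorem4p1 :
  [/\ \sum_(1 <= i < 9) y_of_e hom_coord i = 0,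
      F8 (y_of_e hom_coord) = - (2 ^+ 4 * 3 ^+ 4) * hA00,
      \sum_(1 <= i < 8) e_of_y y_coord i = 3 * e_of_y y_coord 0,
      subst_hom hA00 (e_of_y y_coord) = - (6^-1 *: F8 y_coord)
    & forall (B : seq nat) (s : nat -> nat), B \in blocks -> permutes B s ->
      [/\ subst_aff A00 (aff_coord \o s) = A00,
          subst_hom hA00 (hom_coord \o s) = hA00,
          F8 (y_coord \o s) = F8 y_coord,
          forall i : nat, (0 < i < 9)%N ->
            y_of_e (hom_coord \o s) i = y_of_e hom_coord (s i)
        & forall i : nat, (i < 8)%N ->
            e_of_y (y_coord \o s) i = e_of_y y_coord (s i)]].
Proof.
split; [exact: sum_y_of_e| |exact: sum_e_of_y| |].
- rewrite (F8_y_of_e sum_hom_coord) hA00_cubic -scalerAr.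
  (* 2^4 * 3^4 = 54 * 24, so the factor 54 cancels. *)
  set F := LHS; rewrite (_ : _ * _ = F *+ 54).
    by rewrite -scaler_nat scalerA mulVf // scale1r.
  by rewrite /F; ring.
- rewrite subst_hA00; last exact: sum_e_of_y.
  rewrite (cubic_e_of_y sum_y_coord).
  rewrite !mulNr mulr_natl scalerN -scaler_nat scalerA.
  by congr (- (_ *: _)).
move=> B s Bb s_perm; have sum_s := sum_permutes _ (blocks_sub Bb) s_perm.
have s0 : s 0%N = 0%N.
  by apply: s_perm.2; apply/negP => /(blocks_sub Bb).
split.
- rewrite subst_A00 ?sum_s ?sum_aff_coord // A00_cubic.
  rewrite -(cubic_block (dehom aff_coord) Bb s_perm).
  (* [s] fixes 0 and, being injective, sends no positive index to 0, so it respects the case split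
     in [dehom]. *)
  have s_dehom : dehom (aff_coord \o s) =1 dehom aff_coord \o s.
    case=> [|i] /=; first by rewrite s0.
    have : s i.+1 != s 0%N by rewrite (bij_eq s_perm.1).
    by rewrite s0; case: (s i.+1).
  congr (_ *: _); apply: eq_cubic => [i _|]; first exact: s_dehom.
  by apply: eq_bigr => i _; apply: s_dehom.
- rewrite subst_hA00 ?sum_s; last by rewrite /= s0 sum_hom_coord.
  by rewrite (cubic_block _ Bb s_perm) hA00_cubic.
(* The blocks lie in 1..7, hence also in the range 1..8 of the sum; [y_8] is fixed. *)
- apply: (sum_permutes (fun i => y_coord i ^+ 3)) s_perm => i /(blocks_sub Bb).
  by rewrite !mem_index_iota => /andP[-> /ltnW].
- by move=> i; apply: y_of_e_block Bb s_perm; exact: sum_hom_coord.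
- by move=> i; apply: e_of_y_block Bb s_perm.
Qed.
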